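(* For every $\varepsilon>0$ there is a number $\delta(\varepsilon)\in(0,1/2)$ such that for all $0<\alpha<\beta<\pi$ and every constant $M>0$ there is a finite constant $C=C(\varepsilon,\alpha,\beta,M)$ with the following property. Let $F\in\mathcal{B}(\Omega_\alpha^{1/2})$ with $C_F=M$, that is, $F$ is analytic in $\Omega_\alpha^{1/2}$ and $|F'(z)|\le M/|z|$ for all $z\in\Omega_\alpha^{1/2}$. Then there exists a (real-valued) harmonic function $u$ in $\Omega_\beta$ such that 1) $|u(x)-\mathrm{Re}\, F(x)|\le \varepsilon$ for all $x\in(0,\delta(\varepsilon)]$; 2) $|\tilde u(z)|\le C(\varepsilon,\alpha,\beta,M)<\infty$ for all $z\in\Omega_\beta$.
   Context: For $r>0$ and $0<\alpha<\pi$, $\Omega_\alpha^r=\{z\in\mathbb{C}: 0<|z|<r,\ \arg z\in(-\alpha/2,\alpha/2)\}$, and $\Omega_\alpha=\Omega_\alpha^1$. The class $\mathcal{B}(\Omega_\alpha^r)$ consists of the functions $F$ analytic in $\Omega_\alpha^r$ for which there is a constant $C_F$ with $|F'(z)|\le C_F/|z|$ for all $z\in\Omega_\alpha^r$. For a harmonic function $u$ on $\Omega_\beta$, $\tilde u$ denotes the harmonic conjugate of $u$ in $\Omega_\beta$ normalized by $\tilde u(1/2)=0$ (so that $u+i\tilde u$ is analytic in $\Omega_\beta$). *)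

(* Defs.v *)
From Stdlib Require Import Reals.
From Coquelicot Require Import Coquelicot.
Open Scope R_scope.

(** In Coquelicot [C] is [R * R], so a function [C -> R] is a function of the
    two real variables [x = fst z] and [y = snd z]. *)

Definition principal_arg (z : C) (t : R) : Prop :=
  z <> RtoC 0 /\ - PI < t <= PI /\
  z = (RtoC (Cmod z) * (cos t, sin t))%C.

Definition sector (r alpha : R) (z : C) : Prop :=
  0 < Cmod z < r /\
  exists t, principal_arg z t /\ - (alpha / 2) < t < alpha / 2.

(** Analyticity is meant for open [D]; it is complex differentiability at
    every point of [D]. *)
Definition analytic_on (D : C -> Prop) (f : C -> C) : Prop :=
  forall z, D z -> ex_derive (K := C_AbsRing) (V := C_NormedModule) f z.

(** Membership in the class B of the sector, [M] being an admissible [C_f]. *)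
Definition class_B_with (r alpha M : R) (f : C -> C) : Prop :=
  analytic_on (sector r alpha) f /\
  forall z, sector r alpha z -> Cmod (C_derive f z) <= M / Cmod z.

Definition pdx (u : C -> R) (z : C) : R :=
  Derive (fun t => u (t, snd z)) (fst z).

Definition pdy (u : C -> R) (z : C) : R :=
  Derive (fun t => u (fst z, t)) (snd z).

Definition C1_on (D : C -> Prop) (u : C -> R) : Prop :=
  forall z, D z ->
    ex_derive (fun t => u (t, snd z)) (fst z) /\
    ex_derive (fun t => u (fst z, t)) (snd z) /\
    continuous (T := C_UniformSpace) (U := R_UniformSpace) (pdx u) z /\
    continuous (T := C_UniformSpace) (U := R_UniformSpace) (pdy u) z.

Definition C2_on (D : C -> Prop) (u : C -> R) : Prop :=
  C1_on D u /\ C1_on D (pdx u) /\ C1_on D (pdy u).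

Definition harmonic_on (D : C -> Prop) (u : C -> R) : Prop :=
  C2_on D u /\ forall z, D z -> pdx (pdx u) z + pdy (pdy u) z = 0.

(** On a connected [D] containing [z0] there is at most one such [v] up to its
    values outside [D]: the additive constant is fixed by [v z0 = 0]. *)
Definition harmonic_conjugate (D : C -> Prop) (z0 : C) (u v : C -> R) : Prop :=
  harmonic_on D v /\
  analytic_on D (fun z => (RtoC (u z) + Ci * RtoC (v z))%C) /\
  v z0 = 0.

(* Main.v *)
Require Import Defs.
From Stdlib Require Import Reals Lra Lia.
From Coquelicot Require Import Coquelicot.
Open Scope R_scope.

(** Only the values of [f x = Re (F x)] on the positive axis matter, and of
    the class B only the inequality [|f' x| <= M / x] there: [f] changes by at
    most [A = M (1/q - 1)] between the consecutive nodes [y n = q^n / 4], for a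
    ratio [q < 1] fixed so that [A] is [eps / 6].  Hence the step function that
    equals [f (y n)] on the interval between [y (n+1)] and [y n] is uniformly
    close to [f] on (0, 1/4], and it suffices to replace it by an analytic
    function whose imaginary part stays bounded.

    A step at the node [y] is approximated by [sigma (t)], where
    [t = y / (z + y)] and [sigma] is a real polynomial.  For real [z = x] the
    number [t] runs through (0, 1) and passes 1/2 at [x = y]; taking for [sigma]
    a high iterate of the cubic [3 t^2 - 2 t^3], which maps 0 to 0, 1/2 to 1/2
    and 1 to 1 and pushes all other points of (0, 1) towards 0 or 1, makes the
    step as steep as desired.  On the half-plane [Re z > 0], which
    contains the sector because [beta < PI], both [t] and [1 - t] lie in the
    closed unit disc, so the rational function [sigma (t)] is analytic and
    bounded there.  The approximation is
      [H z = f (y 0) + sum_n (f (y (n+1)) - f (y n)) sigma (y n / (z + y n))],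
    with [u = Re H] and conjugate [Im H], which vanishes for [z > 0].

    Both estimates reduce to [sum_n w n <= 1 / (1 - q)] where
    [w n = r (y n) / (r + y n)^2], a sum that is dominated by a telescoping one.
    For [r = |z|], the identity [sigma (1 - t) = 1 - sigma t] gives
    [|Im sigma (t)| <= L w n], so [Im H] is bounded by [A L / (1 - q)]
    ([Im_smoothstep_le], [blend_Im_le]).  For [r = x], the deviation of
    [sigma (t)] from the exact step is at most [2 eta w n], with [eta] small when
    many iterations are taken, except at the two nodes next to [x], where it is
    at most 1; so [H x] differs from the step function by at most [4 A]
    ([smoothstep_sum]).

    Termwise differentiation of the series stays within series of the same
    form: [z d/dz] turns [p (y / (z + y))] into [q (y / (z + y))] with the
    polynomial [q = - t (1 - t) p'].  This gives all the complex derivatives of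
    [H] that harmonicity of the real and imaginary parts asks for
    ([blend_derive], [blend_harmonic]). *)

(** * Complex derivatives and harmonic functions on the right half-plane *)

Notation is_C_derive := (is_derive (K := C_AbsRing) (V := C_NormedModule)).
Notation ex_C_derive := (ex_derive (K := C_AbsRing) (V := C_NormedModule)).

(** A quadratic remainder survives summation over a series with one uniform
    constant, so derivatives of series are obtained in this form. *)
Lemma is_C_derive_quadratic (f : C -> C) (z l : C) (r K : R) :
  0 < r ->
  (forall w, Cmod (w - z)%C < r ->
     Cmod (f w - f z - (w - z) * l)%C <= K * Cmod (w - z)%C ^ 2) ->
  is_C_derive f z l.
Proof.
  intros Hr Hq; split; [apply is_linear_scal_l|].
  intros x Hx.
  apply (is_filter_lim_locally_unique (V := AbsRing_NormedModule C_AbsRing)) in Hx; subst x.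
  intros eps.
  assert (Hd : 0 < Rmin r (eps / (Rabs K + 1))).
  { apply Rmin_pos; [exact Hr|].
    apply Rdiv_lt_0_compat; [apply cond_pos|]. pose proof (Rabs_pos K); lra. }
  exists (mkposreal _ Hd); intros w Hw.
  change (Cmod (w - z)%C < Rmin r (eps / (Rabs K + 1))) in Hw.
  change (Cmod (f w - f z - (w - z) * l)%C <= eps * Cmod (w - z)%C).
  eapply Rle_trans; [apply Hq|].
  { eapply Rlt_le_trans; [exact Hw|apply Rmin_l]. }
  pose proof (Cmod_ge_0 (w - z)%C) as H0.
  assert (H1 : Cmod (w - z)%C * (Rabs K + 1) <= eps).
  { apply Rle_div_r; [pose proof (Rabs_pos K); lra|].
    left; eapply Rlt_le_trans; [exact Hw|apply Rmin_r]. }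
  pose proof (Rle_abs K).
  replace (K * Cmod (w - z)%C ^ 2) with ((K * Cmod (w - z)%C) * Cmod (w - z)%C) by ring.
  apply Rmult_le_compat_r; nra.
Qed.

Lemma is_C_derive_eps (f : C -> C) (z l : C) :
  is_C_derive f z l ->
  forall eps : posreal, exists d : posreal, forall w,
    Cmod (w - z)%C < d ->
    Cmod (f w - f z - (w - z) * l)%C <= eps * Cmod (w - z)%C.
Proof.
  intros [_ H] eps.
  destruct (H z (fun P HP => HP) eps) as [d Hd].
  exists d; intros w Hw; exact (Hd w Hw).
Qed.

Lemma is_C_derive_mult (f g : C -> C) (z f' g' : C) :
  is_C_derive f z f' ->
  is_C_derive g z g' ->
  is_C_derive (fun w => f w * g w)%C z (f' * g z + f z * g')%C.
Proof.
  (* [is_derive_mult] sees the field as a normed module over itself, a structure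
     that is not [C_NormedModule] but has the same norm. *)
  intros [_ Hf] [_ Hg].
  assert (H : is_derive (K := C_AbsRing) (V := AbsRing_NormedModule C_AbsRing)
      (fun w => f w * g w)%C z (f' * g z + f z * g')%C).
  { apply (is_derive_mult (K := C_AbsRing) f g z f' g');
      [split; [apply is_linear_scal_l|exact Hf]
      |split; [apply is_linear_scal_l|exact Hg]|exact Cmult_comm]. }
  split; [apply is_linear_scal_l|exact (proj2 H)].
Qed.

Lemma is_C_derive_scal (k : C) (f : C -> C) (z f' : C) :
  is_C_derive f z f' ->
  is_C_derive (fun w => k * f w)%C z (k * f')%C.
Proof.
  intros Hf.
  replace (k * f')%C with (0 * f z + k * f')%C by ring.
  apply (is_C_derive_mult (fun _ => k) f z 0 f'); [|exact Hf].
  exact (is_derive_const (K := C_AbsRing) (V := C_NormedModule) k z).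
Qed.

Lemma is_C_derive_add_const (c : C) (f : C -> C) (z f' : C) :
  is_C_derive f z f' ->
  is_C_derive (fun w => c + f w)%C z f'.
Proof.
  intros Hf; replace f' with (0 + f')%C by ring.
  refine (is_derive_plus (K := C_AbsRing) (V := C_NormedModule) _ _ z _ _ _ Hf).
  exact (is_derive_const (K := C_AbsRing) (V := C_NormedModule) c z).
Qed.

Lemma Re_is_derive_x (f : C -> C) (z l : C) :
  is_C_derive f z l ->
  is_derive (fun t => Re (f (t, snd z))) (fst z) (Re l).
Proof.
  intros Hf; split; [apply is_linear_scal_l|].
  intros x Hx.
  apply (is_filter_lim_locally_unique (V := AbsRing_NormedModule R_AbsRing)) in Hx; subst x.
  intros eps; destruct (is_C_derive_eps f z l Hf eps) as [d Hd].
  exists d; intros t Ht.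
  change (Rabs (t - fst z) < d) in Ht.
  change (Rabs (Re (f (t, snd z)) - Re (f (fst z, snd z)) - (t - fst z) * Re l)
    <= eps * Rabs (t - fst z)).
  assert (E : ((t, snd z) - z)%C = RtoC (t - fst z)).
  { destruct z as [a b]; unfold Cminus, Cplus, Copp, RtoC; simpl; f_equal; ring. }
  specialize (Hd (t, snd z)); rewrite E, Cmod_R in Hd.
  eapply Rle_trans; [|apply Hd; exact Ht].
  eapply Rle_trans; [|apply re_le_Cmod].
  right; f_equal; rewrite <- surjective_pairing.
  destruct (f (t, snd z)), (f z), l; simpl; ring.
Qed.

Lemma Re_is_derive_y (f : C -> C) (z l : C) :
  is_C_derive f z l ->
  is_derive (fun t => Re (f (fst z, t))) (snd z) (- Im l).
Proof.
  intros Hf; split; [apply is_linear_scal_l|].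
  intros x Hx.
  apply (is_filter_lim_locally_unique (V := AbsRing_NormedModule R_AbsRing)) in Hx; subst x.
  intros eps; destruct (is_C_derive_eps f z l Hf eps) as [d Hd].
  exists d; intros t Ht.
  change (Rabs (t - snd z) < d) in Ht.
  change (Rabs (Re (f (fst z, t)) - Re (f (fst z, snd z)) - (t - snd z) * - Im l)
    <= eps * Rabs (t - snd z)).
  assert (E : ((fst z, t) - z)%C = (RtoC (t - snd z) * Ci)%C).
  { destruct z as [a b]; unfold Cminus, Cplus, Copp, Cmult, Ci, RtoC; simpl; f_equal; ring. }
  specialize (Hd (fst z, t)); rewrite E, Cmod_mult, Cmod_Ci, Rmult_1_r, Cmod_R in Hd.
  eapply Rle_trans; [|apply Hd; exact Ht].
  eapply Rle_trans; [|apply re_le_Cmod].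
  right; f_equal; rewrite <- surjective_pairing.
  destruct (f (fst z, t)), (f z), l; simpl; ring.
Qed.

(** Continuity in the two real variables refers to the product uniform
    structure, whose balls are squares. *)
Lemma C_ball_of_prod (z w : C) (d : posreal) :
  ball (M := C_UniformSpace) z (d / 2) w -> Cmod (w - z)%C < d.
Proof.
  intros [H1 H2].
  change (Rabs (fst w - fst z) < d / 2) in H1.
  change (Rabs (snd w - snd z) < d / 2) in H2.
  apply Rsqr_incrst_0; [|apply Cmod_ge_0|left; apply cond_pos].
  rewrite !Rsqr_pow2, Cmod2_alt.
  destruct z as [a b], w as [c e]; simpl in *.
  apply Rabs_def2 in H1, H2. nra.
Qed.

Lemma Re_continuous (f : C -> C) (z l : C) :
  is_C_derive f z l ->
  continuous (T := C_UniformSpace) (U := R_UniformSpace) (fun w => Re (f w)) z.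
Proof.
  intros Hf; apply filterlim_locally; intros eps.
  destruct (is_C_derive_eps f z l Hf (mkposreal 1 Rlt_0_1)) as [d Hd].
  pose proof (Cmod_ge_0 l) as Hl.
  assert (He : 0 < Rmin d (eps / (1 + Cmod l)) / 2).
  { apply Rdiv_lt_0_compat; [|lra]; apply Rmin_pos; [apply cond_pos|].
    apply Rdiv_lt_0_compat; [apply cond_pos|lra]. }
  exists (mkposreal _ He); intros w Hw.
  assert (Hm : 0 < Rmin d (eps / (1 + Cmod l))) by lra.
  apply (C_ball_of_prod z w (mkposreal _ Hm)) in Hw; simpl in Hw.
  change (Rabs (Re (f w) - Re (f z)) < eps).
  assert (H1 : Cmod (w - z)%C < d) by (eapply Rlt_le_trans; [exact Hw|apply Rmin_l]).
  assert (H2 : Cmod (w - z)%C * (1 + Cmod l) < eps).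
  { apply Rlt_div_r; [lra|]; eapply Rlt_le_trans; [exact Hw|apply Rmin_r]. }
  apply Hd in H1; simpl in H1.
  replace (Re (f w) - Re (f z)) with (Re (f w - f z)%C)
    by (destruct (f w), (f z); simpl; ring).
  eapply Rle_lt_trans; [apply re_le_Cmod|].
  replace (f w - f z)%C with ((f w - f z - (w - z) * l) + (w - z) * l)%C by ring.
  eapply Rle_lt_trans; [apply Cmod_triangle|]; rewrite Cmod_mult; lra.
Qed.

Definition right_half_plane (z : C) : Prop := 0 < Re z.

Lemma right_half_plane_x (z : C) :
  right_half_plane z -> locally (fst z) (fun t => right_half_plane (t, snd z)).
Proof.
  intros Hz; exists (mkposreal _ Hz); intros t Ht.
  change (Rabs (t - fst z) < fst z) in Ht; apply Rabs_def2 in Ht.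
  unfold right_half_plane; simpl; lra.
Qed.

Lemma right_half_plane_open (z : C) :
  right_half_plane z -> locally (T := C_UniformSpace) z right_half_plane.
Proof.
  intros Hz; exists (mkposreal _ Hz); intros w [Hw _].
  change (Rabs (fst w - fst z) < fst z) in Hw; apply Rabs_def2 in Hw.
  unfold right_half_plane; simpl; unfold Re; lra.
Qed.

(** By the Cauchy-Riemann equations [pdx] is the real part of the complex
    derivative and [pdy] that of [Ci] times it; being again real parts of
    differentiable functions, they can be fed back to this lemma. *)
Lemma C1_on_Re (u : C -> R) (f f1 : C -> C) :
  (forall z, right_half_plane z -> u z = Re (f z)) ->
  (forall z, right_half_plane z -> is_C_derive f z (f1 z)) ->
  (forall z, right_half_plane z -> ex_C_derive f1 z) ->
  C1_on right_half_plane u /\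
  (forall z, right_half_plane z -> pdx u z = Re (f1 z)) /\
  (forall z, right_half_plane z -> pdy u z = Re (Ci * f1 z)%C).
Proof.
  intros Hu Hf Hf1.
  assert (Dx : forall z, right_half_plane z ->
            is_derive (fun t => u (t, snd z)) (fst z) (Re (f1 z))).
  { intros z Hz; eapply is_derive_ext_loc; [|exact (Re_is_derive_x _ _ _ (Hf z Hz))].
    eapply filter_imp; [|exact (right_half_plane_x z Hz)].
    intros t Ht; symmetry; exact (Hu _ Ht). }
  assert (Dy : forall z, right_half_plane z ->
            is_derive (fun t => u (fst z, t)) (snd z) (Re (Ci * f1 z)%C)).
  { intros z Hz; replace (Re (Ci * f1 z)%C) with (- Im (f1 z))
      by (destruct (f1 z); simpl; ring).
    eapply is_derive_ext; [|exact (Re_is_derive_y _ _ _ (Hf z Hz))].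
    intros t; symmetry; apply Hu; exact Hz. }
  assert (Px : forall z, right_half_plane z -> pdx u z = Re (f1 z))
    by (intros z Hz; apply is_derive_unique, Dx, Hz).
  assert (Py : forall z, right_half_plane z -> pdy u z = Re (Ci * f1 z)%C)
    by (intros z Hz; apply is_derive_unique, Dy, Hz).
  split; [|split; assumption].
  intros z Hz; split; [eexists; exact (Dx z Hz)|split; [eexists; exact (Dy z Hz)|split]].
  - eapply continuous_ext_loc; [|destruct (Hf1 z Hz) as [l Hl]; exact (Re_continuous _ _ _ Hl)].
    eapply filter_imp; [|exact (right_half_plane_open z Hz)].
    intros w Hw; symmetry; exact (Px w Hw).
  - destruct (Hf1 z Hz) as [l Hl].
    eapply continuous_ext_loc;
      [|exact (Re_continuous _ _ _ (is_C_derive_scal Ci f1 z l Hl))].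
    eapply filter_imp; [|exact (right_half_plane_open z Hz)].
    intros w Hw; symmetry; exact (Py w Hw).
Qed.

Lemma harmonic_on_Re (f f1 f2 : C -> C) :
  (forall z, right_half_plane z -> is_C_derive f z (f1 z)) ->
  (forall z, right_half_plane z -> is_C_derive f1 z (f2 z)) ->
  (forall z, right_half_plane z -> ex_C_derive f2 z) ->
  harmonic_on right_half_plane (fun z => Re (f z)).
Proof.
  intros H1 H2 H3.
  assert (E1 : forall z, right_half_plane z -> ex_C_derive f1 z)
    by (intros z Hz; eexists; exact (H2 z Hz)).
  destruct (C1_on_Re (fun z => Re (f z)) f f1 (fun _ _ => eq_refl) H1 E1) as [A [Ax Ay]].
  destruct (C1_on_Re _ f1 f2 Ax H2 H3) as [B [Bx _]].
  destruct (C1_on_Re _ (fun z => Ci * f1 z)%C (fun z => Ci * f2 z)%C Ay)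
    as [D [_ Dy]].
  - intros z Hz; apply is_C_derive_scal, H2, Hz.
  - intros z Hz; destruct (H3 z Hz) as [l Hl].
    eexists; exact (is_C_derive_scal Ci f2 z l Hl).
  - split; [split; [exact A|split; [exact B|exact D]]|].
    intros z Hz; rewrite (Bx z Hz), (Dy z Hz).
    destruct (f2 z); simpl; ring.
Qed.

(** * Polynomials with real coefficients as functions on the unit disc *)

(** Expressions rather than lists of coefficients: bounds go by structural
    induction, and iterated polynomials are never expanded. *)
Inductive cpoly : Type :=
| PX : cpoly
| PC : R -> cpoly
| PAdd : cpoly -> cpoly -> cpoly
| PMul : cpoly -> cpoly -> cpoly.

Fixpoint peval (p : cpoly) (t : C) : C :=
  match p with
  | PX => t
  | PC c => RtoC c
  | PAdd p q => (peval p t + peval q t)%C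
  | PMul p q => (peval p t * peval q t)%C
  end.

Fixpoint pderiv (p : cpoly) : cpoly :=
  match p with
  | PX => PC 1
  | PC _ => PC 0
  | PAdd p q => PAdd (pderiv p) (pderiv q)
  | PMul p q => PAdd (PMul (pderiv p) q) (PMul p (pderiv q))
  end.

(** One constant serves as a bound, a Lipschitz constant and a second-order
    Taylor constant, which closes the induction in the product case. *)
Lemma peval_bounds (p : cpoly) :
  exists L, 0 <= L /\ forall s t, Cmod s <= 1 -> Cmod t <= 1 ->
    Cmod (peval p t) <= L /\
    Cmod (peval p s - peval p t)%C <= L * Cmod (s - t)%C /\
    Cmod (peval p s - peval p t - (s - t) * peval (pderiv p) t)%C
      <= L * Cmod (s - t)%C ^ 2.
Proof.
  induction p as [|c|p [L [HL IHp]] q [K [HK IHq]]|p [L [HL IHp]] q [K [HK IHq]]].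
  - exists 1; split; [lra|]; intros s t Hs Ht; simpl; split; [lra|split; [lra|]].
    replace (s - t - (s - t) * 1)%C with (RtoC 0) by ring.
    rewrite Cmod_0; pose proof (Cmod_ge_0 (s - t)%C); nra.
  - exists (Rabs c); split; [apply Rabs_pos|]; intros s t Hs Ht; simpl.
    rewrite Cmod_R; split; [lra|].
    replace (c - c - (s - t) * 0)%C with (RtoC 0) by ring.
    replace (c - c)%C with (RtoC 0) by ring; rewrite Cmod_0.
    pose proof (Cmod_ge_0 (s - t)%C); pose proof (Rabs_pos c); split; nra.
  - exists (L + K); split; [lra|]; intros s t Hs Ht; simpl.
    destruct (IHp s t Hs Ht) as [A1 [A2 A3]], (IHq s t Hs Ht) as [B1 [B2 B3]].
    split; [|split].
    + eapply Rle_trans; [apply Cmod_triangle|lra].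
    + replace (peval p s + peval q s - (peval p t + peval q t))%C
        with ((peval p s - peval p t) + (peval q s - peval q t))%C by ring.
      eapply Rle_trans; [apply Cmod_triangle|lra].
    + replace (peval p s + peval q s - (peval p t + peval q t) -
          (s - t) * (peval (pderiv p) t + peval (pderiv q) t))%C
        with ((peval p s - peval p t - (s - t) * peval (pderiv p) t)
          + (peval q s - peval q t - (s - t) * peval (pderiv q) t))%C by ring.
      eapply Rle_trans; [apply Cmod_triangle|simpl in *; lra].
  - exists (3 * (L * K)); split; [nra|]; intros s t Hs Ht; simpl.
    destruct (IHp s t Hs Ht) as [A1 [A2 A3]], (IHq s t Hs Ht) as [B1 [B2 B3]].
    destruct (IHp s s Hs Hs) as [A4 _].
    pose proof (Cmod_ge_0 (s - t)%C) as D0.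
    pose proof (Cmod_ge_0 (peval p t)); pose proof (Cmod_ge_0 (peval q t)).
    pose proof (Cmod_ge_0 (peval p s)).
    pose proof (Cmod_ge_0 (peval p s - peval p t)%C).
    pose proof (Cmod_ge_0 (peval q s - peval q t)%C).
    pose proof (Cmod_ge_0 (peval p s - peval p t - (s - t) * peval (pderiv p) t)%C).
    pose proof (Cmod_ge_0 (peval q s - peval q t - (s - t) * peval (pderiv q) t)%C).
    assert (0 <= L * K) by nra.
    split; [|split].
    + rewrite Cmod_mult.
      apply Rle_trans with (L * K); [apply Rmult_le_compat|]; nra.
    + replace (peval p s * peval q s - peval p t * peval q t)%C
        with (peval p s * (peval q s - peval q t) +
              (peval p s - peval p t) * peval q t)%C by ring.
      eapply Rle_trans; [apply Cmod_triangle|]; rewrite !Cmod_mult.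
      pose proof (Rmult_le_compat _ _ _ _ (Cmod_ge_0 _) (Cmod_ge_0 _) A4 B2).
      pose proof (Rmult_le_compat _ _ _ _ (Cmod_ge_0 _) (Cmod_ge_0 _) A2 B1).
      nra.
    + replace (peval p s * peval q s - peval p t * peval q t -
          (s - t) * (peval (pderiv p) t * peval q t + peval p t * peval (pderiv q) t))%C
        with ((peval p s - peval p t - (s - t) * peval (pderiv p) t) * peval q t
          + peval p t * (peval q s - peval q t - (s - t) * peval (pderiv q) t)
          + (peval p s - peval p t) * (peval q s - peval q t))%C by ring.
      eapply Rle_trans; [apply Cmod_triangle|].
      eapply Rle_trans; [apply Rplus_le_compat_r, Cmod_triangle|]; rewrite !Cmod_mult.
      pose proof (Rmult_le_compat _ _ _ _ (Cmod_ge_0 _) (Cmod_ge_0 _) A3 B1).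
      pose proof (Rmult_le_compat _ _ _ _ (Cmod_ge_0 _) (Cmod_ge_0 _) A1 B3).
      pose proof (Rmult_le_compat _ _ _ _ (Cmod_ge_0 _) (Cmod_ge_0 _) A2 B2).
      simpl in *; nra.
Qed.

Lemma peval_Lipschitz_at_0 (p : cpoly) :
  peval p 0 = 0 ->
  exists L, 0 <= L /\ forall t, Cmod t <= 1 -> Cmod (peval p t) <= L * Cmod t.
Proof.
  intros H0; destruct (peval_bounds p) as [L [HL H]]; exists L; split; [exact HL|].
  intros t Ht; destruct (H t 0 Ht ltac:(rewrite Cmod_0; lra)) as [_ [H1 _]].
  rewrite H0 in H1.
  replace (peval p t - 0)%C with (peval p t) in H1 by ring.
  replace (t - 0)%C with t in H1 by ring; exact H1.
Qed.

(** * Absolutely convergent complex series *)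

Definition CSeries (a : nat -> C) : C :=
  (Series (fun n => Re (a n)), Series (fun n => Im (a n))).

Definition abs_summable (a : nat -> C) : Prop := ex_series (fun n => Cmod (a n)).

Lemma im_le_Cmod (z : C) : Rabs (Im z) <= Cmod z.
Proof. eapply Rle_trans; [apply Rmax_r|apply Rmax_Cmod]. Qed.

Lemma Cmod_le_Re_Im (z : C) : Cmod z <= Rabs (Re z) + Rabs (Im z).
Proof.
  apply Rsqr_incr_0_var.
  - rewrite !Rsqr_pow2, Cmod2_alt.
    pose proof (Rabs_pos (Re z)); pose proof (Rabs_pos (Im z)).
    rewrite <- (pow2_abs (Re z)), <- (pow2_abs (Im z)); nra.
  - pose proof (Rabs_pos (Re z)); pose proof (Rabs_pos (Im z)); lra.
Qed.

Lemma ex_series_le_R (a b : nat -> R) :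
  (forall n, Rabs (a n) <= b n) -> ex_series b -> ex_series a.
Proof. exact (ex_series_le (K := R_AbsRing) (V := R_CompleteNormedModule) a b). Qed.

Lemma Series_abs_le (a b : nat -> R) :
  (forall n, Rabs (a n) <= b n) -> ex_series b -> Rabs (Series a) <= Series b.
Proof.
  intros H Hb; eapply Rle_trans; [apply Series_Rabs|].
  - apply ex_series_le_R with b; [|exact Hb]; intros n; rewrite Rabs_Rabsolu; apply H.
  - apply Series_le; [|exact Hb]; intros n; split; [apply Rabs_pos|apply H].
Qed.

Lemma abs_summable_Re (a : nat -> C) : abs_summable a -> ex_series (fun n => Re (a n)).
Proof. intros H; eapply ex_series_le_R; [|exact H]; intros n; apply re_le_Cmod. Qed.

Lemma abs_summable_Im (a : nat -> C) : abs_summable a -> ex_series (fun n => Im (a n)).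
Proof. intros H; eapply ex_series_le_R; [|exact H]; intros n; apply im_le_Cmod. Qed.

Lemma CSeries_minus (a b : nat -> C) :
  abs_summable a -> abs_summable b ->
  CSeries (fun n => a n - b n)%C = (CSeries a - CSeries b)%C.
Proof.
  intros Ha Hb; apply injective_projections.
  - transitivity (Series (fun n => Re (a n) - Re (b n))).
    + apply Series_ext; intros n; destruct (a n), (b n); reflexivity.
    + exact (Series_minus _ _ (abs_summable_Re _ Ha) (abs_summable_Re _ Hb)).
  - transitivity (Series (fun n => Im (a n) - Im (b n))).
    + apply Series_ext; intros n; destruct (a n), (b n); reflexivity.
    + exact (Series_minus _ _ (abs_summable_Im _ Ha) (abs_summable_Im _ Hb)).
Qed.

Lemma CSeries_scal (c : C) (a : nat -> C) :
  abs_summable a -> CSeries (fun n => c * a n)%C = (c * CSeries a)%C.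
Proof.
  intros Ha.
  pose proof (abs_summable_Re _ Ha) as HR; pose proof (abs_summable_Im _ Ha) as HI.
  assert (sc : forall (k : R) (b : nat -> R), ex_series b -> ex_series (fun n => k * b n)).
  { intros k b Hb; exact (ex_series_scal_l (K := R_AbsRing) k b Hb). }
  apply injective_projections.
  - change (Series (fun n => Re (c * a n)%C) =
      Re c * Series (fun n => Re (a n)) - Im c * Series (fun n => Im (a n))).
    rewrite <- !Series_scal_l, <- Series_minus by (apply sc; assumption).
    apply Series_ext; intros n; apply re_mult.
  - change (Series (fun n => Im (c * a n)%C) =
      Re c * Series (fun n => Im (a n)) + Im c * Series (fun n => Re (a n))).
    rewrite <- !Series_scal_l, <- Series_plus by (apply sc; assumption).
    apply Series_ext; intros n; rewrite im_mult; ring.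
Qed.

Lemma CSeries_le (a : nat -> C) (b : nat -> R) :
  (forall n, Cmod (a n) <= b n) -> ex_series b -> Cmod (CSeries a) <= 2 * Series b.
Proof.
  intros H Hb; eapply Rle_trans; [apply Cmod_le_Re_Im|].
  assert (Rabs (Re (CSeries a)) <= Series b).
  { apply Series_abs_le; [|exact Hb]; intros n.
    eapply Rle_trans; [apply re_le_Cmod|apply H]. }
  assert (Rabs (Im (CSeries a)) <= Series b).
  { apply Series_abs_le; [|exact Hb]; intros n.
    eapply Rle_trans; [apply im_le_Cmod|apply H]. }
  lra.
Qed.

Lemma abs_summable_scal (c : C) (a : nat -> C) :
  abs_summable a -> abs_summable (fun n => c * a n)%C.
Proof.
  intros H; unfold abs_summable.
  apply ex_series_ext with (fun n => Cmod c * Cmod (a n)).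
  - intros n; rewrite Cmod_mult; reflexivity.
  - exact (ex_series_scal_l (K := R_AbsRing) (Cmod c) _ H).
Qed.

Lemma abs_summable_minus (a b : nat -> C) :
  abs_summable a -> abs_summable b -> abs_summable (fun n => a n - b n)%C.
Proof.
  intros Ha Hb; eapply ex_series_le_R.
  2: exact (ex_series_plus (K := R_AbsRing) (V := R_NormedModule) _ _ Ha Hb).
  intros n; rewrite Rabs_pos_eq by apply Cmod_ge_0.
  unfold Cminus; eapply Rle_trans; [apply Cmod_triangle|]; rewrite Cmod_opp; right; reflexivity.
Qed.

(** * The map y / (z + y) and series in it *)

Lemma right_half_plane_neq_0 (z : C) : right_half_plane z -> z <> 0.
Proof. unfold right_half_plane; intros H E; rewrite E in H; simpl in H; lra. Qed.

Lemma half_disc_right (z w : C) :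
  Cmod (w - z)%C < Re z / 2 -> Re z / 2 <= Re w.
Proof.
  intros Hw; pose proof (re_le_Cmod (w - z)%C) as E.
  assert (Rabs (Re (w - z)%C) < Re z / 2) as E' by lra.
  apply Rabs_def2 in E'.
  replace (Re (w - z)%C) with (Re w - Re z) in E' by (destruct w, z; simpl; ring).
  lra.
Qed.

Lemma Re_le_Cmod (z : C) : Re z <= Cmod z.
Proof. eapply Rle_trans; [apply Rle_abs|apply re_le_Cmod]. Qed.

Lemma is_C_derive_inv (z : C) :
  right_half_plane z ->
  is_C_derive Cinv z (- (/ z * / z))%C.
Proof.
  intros Hz; pose proof (right_half_plane_neq_0 z Hz) as Nz.
  set (rho := Re z / 2); assert (Hrho : 0 < rho) by (unfold rho, right_half_plane in *; lra).
  apply is_C_derive_quadratic with rho (/ rho ^ 3); [exact Hrho|].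
  intros w Hw; apply half_disc_right in Hw; fold rho in Hw.
  assert (Nw : w <> 0) by (apply right_half_plane_neq_0; unfold right_half_plane; lra).
  replace (/ w - / z - (w - z) * - (/ z * / z))%C
    with ((w - z) * (w - z) * / (w * (z * z)))%C by (field; auto).
  rewrite !Cmod_mult, Cmod_inv, !Cmod_mult by (repeat apply Cmult_neq_0; assumption).
  replace (/ rho ^ 3 * Cmod (w - z)%C ^ 2)
    with (Cmod (w - z)%C * Cmod (w - z)%C * / (rho * (rho * rho))) by (field; lra).
  apply Rmult_le_compat_l; [apply Rmult_le_pos; apply Cmod_ge_0|].
  assert (rho <= Cmod z) by (pose proof (Re_le_Cmod z); unfold rho, right_half_plane in *; lra).
  assert (rho <= Cmod w) by (pose proof (Re_le_Cmod w); lra).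
  clearbody rho.
  apply Rinv_le_contravar; [repeat apply Rmult_lt_0_compat; exact Hrho|].
  repeat apply Rmult_le_compat; try lra; nra.
Qed.

Definition moebius (y : R) (z : C) : C := (y / (z + y))%C.

Lemma Cmod_shift_ge_l (z : C) (y : R) :
  right_half_plane z -> 0 < y -> Cmod z <= Cmod (z + y)%C.
Proof.
  unfold right_half_plane; intros Hz Hy; apply Rsqr_incr_0_var; [|apply Cmod_ge_0].
  rewrite !Rsqr_pow2, !Cmod2_alt; destruct z as [a b]; simpl in *; rewrite Rplus_0_r; nra.
Qed.

Lemma Cmod_shift_ge_r (z : C) (y : R) :
  right_half_plane z -> 0 < y -> y <= Cmod (z + y)%C.
Proof.
  unfold right_half_plane; intros Hz Hy; eapply Rle_trans; [|apply Re_le_Cmod].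
  destruct z as [a b]; simpl in *; lra.
Qed.

Lemma shift_neq_0 (z : C) (y : R) : right_half_plane z -> 0 < y -> (z + y)%C <> 0.
Proof.
  intros Hz Hy; apply right_half_plane_neq_0; unfold right_half_plane in *.
  destruct z; simpl in *; lra.
Qed.

(** Both [t = moebius y z] and [1 - t] stay in the closed unit disc; [t] is also
    small when [y] is much smaller than [z], and [1 - t] when it is much larger. *)
Lemma Cmod_moebius_le_1 (y : R) (z : C) :
  right_half_plane z -> 0 < y -> Cmod (moebius y z) <= 1.
Proof.
  intros Hz Hy; unfold moebius; rewrite Cmod_div by (apply shift_neq_0; assumption).
  pose proof (Cmod_shift_ge_r z y Hz Hy).
  rewrite Cmod_R, Rabs_pos_eq by lra; apply Rle_div_l; lra.
Qed.

Lemma Cmod_moebius_le (y : R) (z : C) :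
  right_half_plane z -> 0 < y -> Cmod (moebius y z) <= y / Cmod z.
Proof.
  intros Hz Hy; unfold moebius; rewrite Cmod_div by (apply shift_neq_0; assumption).
  pose proof (Cmod_shift_ge_l z y Hz Hy).
  pose proof (proj1 (Cmod_gt_0 z) (right_half_plane_neq_0 z Hz)).
  rewrite Cmod_R, Rabs_pos_eq by lra; apply Rmult_le_compat_l; [lra|].
  apply Rinv_le_contravar; lra.
Qed.

Lemma one_minus_moebius (y : R) (z : C) :
  right_half_plane z -> 0 < y -> (1 - moebius y z)%C = (z / (z + y))%C.
Proof. intros Hz Hy; unfold moebius; field; apply shift_neq_0; assumption. Qed.

Lemma Cmod_one_minus_moebius (y : R) (z : C) :
  right_half_plane z -> 0 < y ->
  Cmod (1 - moebius y z)%C <= 1 /\ Cmod (1 - moebius y z)%C <= Cmod z / y.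
Proof.
  intros Hz Hy; rewrite one_minus_moebius by assumption.
  pose proof (shift_neq_0 z y Hz Hy) as N.
  rewrite Cmod_div by exact N.
  pose proof (Cmod_shift_ge_l z y Hz Hy); pose proof (Cmod_shift_ge_r z y Hz Hy).
  pose proof (proj1 (Cmod_gt_0 z) (right_half_plane_neq_0 z Hz)).
  split; [apply Rle_div_l; lra|].
  apply Rmult_le_compat_l; [lra|]; apply Rinv_le_contravar; lra.
Qed.

Definition blend (a y : nat -> R) (p : cpoly) (z : C) : C :=
  CSeries (fun n => a n * peval p (moebius (y n) z))%C.

(** Evaluated at [t = moebius y z], this is [z d/dz] of [p], because
    [z dt/dz = - t (1 - t)]. *)
Definition euler (p : cpoly) : cpoly :=
  PMul (PMul PX (PAdd PX (PC (-1)))) (pderiv p).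

Lemma euler_0 (p : cpoly) : peval (euler p) 0 = 0.
Proof. simpl; ring. Qed.

(** The factor [y0] in the remainder is what makes the remainders summable over
    the nodes. *)
Lemma blend_term_quadratic (p : cpoly) (z : C) :
  right_half_plane z ->
  exists K, 0 <= K /\ forall w y0, 0 < y0 <= 1 -> Cmod (w - z)%C < Re z / 2 ->
    Cmod (peval p (moebius y0 w) - peval p (moebius y0 z)
          - (w - z) / z * peval (euler p) (moebius y0 z))%C
      <= K * y0 * Cmod (w - z)%C ^ 2.
Proof.
  intros Hz; destruct (peval_bounds p) as [L [HL H]].
  destruct (peval_bounds (pderiv p)) as [L' [HL' H']].
  set (rho := Re z / 2); assert (Hrho : 0 < rho) by (unfold rho, right_half_plane in *; lra).
  exists (L / rho ^ 4 + L' / rho ^ 3); split.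
  { apply Rplus_le_le_0_compat; apply Rdiv_le_0_compat; auto; apply pow_lt; exact Hrho. }
  intros w y0 [Hy0 Hy1] Hw.
  assert (Hwr : rho <= Re w).
  { apply half_disc_right; exact Hw. }
  assert (Hw' : right_half_plane w) by (unfold right_half_plane; lra).
  pose proof (shift_neq_0 z y0 Hz Hy0) as Nz; pose proof (shift_neq_0 w y0 Hw' Hy0) as Nw.
  pose proof (right_half_plane_neq_0 z Hz) as Nz0.
  assert (Bz : rho <= Cmod (z + y0)%C).
  { eapply Rle_trans; [|apply Cmod_shift_ge_l; assumption].
    eapply Rle_trans; [|apply Re_le_Cmod]; unfold rho, right_half_plane in *; lra. }
  assert (Bw : rho <= Cmod (w + y0)%C).
  { eapply Rle_trans; [|apply Cmod_shift_ge_l; assumption].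
    eapply Rle_trans; [|apply Re_le_Cmod]; exact Hwr. }
  set (d := Cmod (w - z)%C); assert (Hd : 0 <= d) by apply Cmod_ge_0.
  assert (Iz : 0 < / Cmod (z + y0)%C <= / rho).
  { split; [apply Rinv_0_lt_compat; lra|apply Rinv_le_contravar; lra]. }
  assert (Iw : 0 < / Cmod (w + y0)%C <= / rho).
  { split; [apply Rinv_0_lt_compat; lra|apply Rinv_le_contravar; lra]. }
  set (t := moebius y0 z) in *; set (s := moebius y0 w) in *.
  assert (E1 : Cmod (s - t)%C <= d * y0 * / rho ^ 2).
  { replace (s - t)%C with (- ((w - z) * y0 / ((w + y0) * (z + y0))))%C
      by (unfold s, t, moebius; field; auto).
    rewrite Cmod_opp, Cmod_div, !Cmod_mult, Cmod_R, Rabs_pos_eq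
      by (try lra; apply Cmult_neq_0; assumption).
    fold d; unfold Rdiv; apply Rmult_le_compat_l; [nra|].
    rewrite Rinv_mult; replace (/ rho ^ 2) with (/ rho * / rho) by (field; lra).
    apply Rmult_le_compat; lra. }
  assert (E2 : Cmod (s - t - (w - z) / z * (t * (t - 1)))%C <= d ^ 2 * y0 * / rho ^ 3).
  { replace (s - t - (w - z) / z * (t * (t - 1)))%C
      with ((w - z) * (w - z) * y0 / ((w + y0) * ((z + y0) * (z + y0))))%C
      by (unfold s, t, moebius; field; auto).
    rewrite Cmod_div, !Cmod_mult, Cmod_R, Rabs_pos_eq
      by (try lra; repeat apply Cmult_neq_0; assumption).
    fold d; replace (d ^ 2 * y0 * / rho ^ 3)
      with ((d * d * y0) * (/ rho * (/ rho * / rho))) by (field; lra).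
    unfold Rdiv; apply Rmult_le_compat_l; [nra|].
    rewrite !Rinv_mult; repeat apply Rmult_le_compat; try lra; nra. }
  destruct (H s t (Cmod_moebius_le_1 y0 w Hw' Hy0) (Cmod_moebius_le_1 y0 z Hz Hy0))
    as [_ [_ E3]].
  destruct (H' s t (Cmod_moebius_le_1 y0 w Hw' Hy0) (Cmod_moebius_le_1 y0 z Hz Hy0))
    as [E4 _].
  replace (peval p s - peval p t - (w - z) / z * peval (euler p) t)%C
    with ((peval p s - peval p t - (s - t) * peval (pderiv p) t)
      + (s - t - (w - z) / z * (t * (t - 1))) * peval (pderiv p) t)%C
    by (simpl; field; assumption).
  eapply Rle_trans; [apply Cmod_triangle|]; rewrite Cmod_mult.
  assert (E5 : L * Cmod (s - t)%C ^ 2 <= L / rho ^ 4 * y0 * d ^ 2).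
  { apply Rle_trans with (L * ((d * y0 * / rho ^ 2) ^ 2)).
    - apply Rmult_le_compat_l; [exact HL|]; apply pow_incr; split; [apply Cmod_ge_0|exact E1].
    - replace (L * (d * y0 * / rho ^ 2) ^ 2) with ((L / rho ^ 4 * y0 * d ^ 2) * y0)
        by (field; lra).
      rewrite <- (Rmult_1_r (L / rho ^ 4 * y0 * d ^ 2)) at 2.
      apply Rmult_le_compat_l; [|exact Hy1].
      apply Rmult_le_pos; [apply Rmult_le_pos; [|lra]|apply pow2_ge_0].
      apply Rdiv_le_0_compat; [exact HL|apply pow_lt; exact Hrho]. }
  assert (E6 : Cmod (s - t - (w - z) / z * (t * (t - 1)))%C * Cmod (peval (pderiv p) t)
     <= d ^ 2 * y0 * / rho ^ 3 * L').
  { apply Rmult_le_compat; auto using Cmod_ge_0. }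
  replace ((L / rho ^ 4 + L' / rho ^ 3) * y0 * d ^ 2)
    with (L / rho ^ 4 * y0 * d ^ 2 + d ^ 2 * y0 * / rho ^ 3 * L') by (field; lra).
  lra.
Qed.

Section Blend.

Variables (a y : nat -> R) (A : R).
Hypothesis Ha : forall n, Rabs (a n) <= A.
Hypothesis Hy : forall n, 0 < y n <= 1.
Hypothesis Hs : ex_series y.

Lemma blend_summable (p : cpoly) (z : C) :
  right_half_plane z -> peval p 0 = 0 ->
  abs_summable (fun n => a n * peval p (moebius (y n) z))%C.
Proof.
  intros Hz H0; destruct (peval_Lipschitz_at_0 p H0) as [L [HL H]].
  pose proof (proj1 (Cmod_gt_0 z) (right_half_plane_neq_0 z Hz)) as Hp.
  apply ex_series_le_R with (fun n => (A * L / Cmod z) * y n).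
  - intros n; rewrite Rabs_pos_eq by apply Cmod_ge_0.
    rewrite Cmod_mult, Cmod_R; destruct (Hy n) as [Hn _].
    specialize (H _ (Cmod_moebius_le_1 (y n) z Hz Hn)).
    pose proof (Cmod_moebius_le (y n) z Hz Hn).
    replace (A * L / Cmod z * y n) with (A * (L * (y n / Cmod z))) by (field; lra).
    apply Rmult_le_compat; [apply Rabs_pos|apply Cmod_ge_0|apply Ha|].
    eapply Rle_trans; [exact H|]; apply Rmult_le_compat_l; assumption.
  - exact (ex_series_scal_l (K := R_AbsRing) (A * L / Cmod z) y Hs).
Qed.

(** The derivative is [/ z] times a series of the same kind whose polynomial
    again vanishes at 0, so the lemma applies to it in turn. *)
Lemma blend_derive (p : cpoly) (z : C) :
  right_half_plane z -> peval p 0 = 0 ->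
  is_C_derive (blend a y p) z (/ z * blend a y (euler p) z)%C.
Proof.
  intros Hz H0; destruct (blend_term_quadratic p z Hz) as [K [HK HQ]].
  apply is_C_derive_quadratic with (r := Re z / 2) (K := 2 * (A * K * Series y)).
  { unfold right_half_plane in Hz; lra. }
  intros w Hw.
  assert (Hw' : right_half_plane w).
  { apply half_disc_right in Hw; unfold right_half_plane in *; lra. }
  pose proof (blend_summable p w Hw' H0) as S1.
  pose proof (blend_summable p z Hz H0) as S2.
  pose proof (blend_summable (euler p) z Hz (euler_0 p)) as S3.
  unfold blend.
  rewrite Cmult_assoc, <- (CSeries_scal _ _ S3), <- (CSeries_minus _ _ S1 S2).
  rewrite <- CSeries_minus
    by first [apply abs_summable_minus; assumption | apply abs_summable_scal; assumption].
  replace (2 * (A * K * Series y) * Cmod (w - z)%C ^ 2)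
    with (2 * Series (fun n => (A * K * Cmod (w - z)%C ^ 2) * y n))
    by (rewrite Series_scal_l; ring).
  apply CSeries_le; [|exact (ex_series_scal_l (K := R_AbsRing) _ y Hs)].
  intros n; specialize (HQ w (y n) (Hy n) Hw).
  match goal with |- Cmod ?e <= _ => replace e with
    (a n * (peval p (moebius (y n) w) - peval p (moebius (y n) z)
          - (w - z) / z * peval (euler p) (moebius (y n) z)))%C
    by (unfold Cdiv; ring) end.
  rewrite Cmod_mult, Cmod_R.
  replace (A * K * Cmod (w - z)%C ^ 2 * y n) with (A * (K * y n * Cmod (w - z)%C ^ 2)) by ring.
  apply Rmult_le_compat; auto using Rabs_pos, Cmod_ge_0.
Qed.

(** Taking [k = - Ci] yields the imaginary part, so this covers the harmonic
    function as well as its conjugate. *)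
Lemma blend_harmonic (p : cpoly) (c k : C) :
  peval p 0 = 0 ->
  harmonic_on right_half_plane (fun z => Re (c + k * blend a y p z)%C).
Proof.
  intros H0.
  pose (h := fun q z => (/ z * blend a y (euler q) z)%C).
  assert (Dh : forall q z, right_half_plane z ->
    is_C_derive (h q) z
      (- (/ z * / z) * blend a y (euler q) z + / z * h (euler q) z)%C).
  { intros q z Hz; apply is_C_derive_mult; [exact (is_C_derive_inv z Hz)|].
    apply blend_derive; [exact Hz|apply euler_0]. }
  eapply harmonic_on_Re.
  - intros z Hz; apply is_C_derive_add_const, is_C_derive_scal, (blend_derive p z Hz H0).
  - intros z Hz; apply is_C_derive_scal, (Dh p z Hz).
  - intros z Hz; eexists; apply is_C_derive_scal.
    refine (is_derive_plus (K := C_AbsRing) (V := C_NormedModule) _ _ z _ _ _ _).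
    + apply is_C_derive_mult; [|apply blend_derive; [exact Hz|apply euler_0]].
      refine (is_derive_opp (K := C_AbsRing) (V := C_NormedModule) _ z _ _).
      apply is_C_derive_mult; exact (is_C_derive_inv z Hz).
    + apply is_C_derive_mult; [exact (is_C_derive_inv z Hz)|exact (Dh (euler p) z Hz)].
Qed.

End Blend.

(** * Steep polynomial steps *)

Fixpoint smoothstep (k : nat) (t : R) : R :=
  match k with
  | O => t
  | S k => smoothstep k t ^ 2 * (3 - 2 * smoothstep k t)
  end.

Fixpoint smoothstep_poly (k : nat) : cpoly :=
  match k with
  | O => PX
  | S k => PMul (PMul (smoothstep_poly k) (smoothstep_poly k))
             (PAdd (PC 3) (PMul (PC (-2)) (smoothstep_poly k)))
  end.

Lemma smoothstep_poly_R (k : nat) (t : R) :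
  peval (smoothstep_poly k) t = smoothstep k t.
Proof.
  induction k as [|k IH]; [reflexivity|].
  simpl; rewrite IH, <- !RtoC_mult, <- RtoC_plus, <- RtoC_mult; f_equal; ring.
Qed.

Lemma smoothstep_poly_0 (k : nat) : peval (smoothstep_poly k) 0 = 0.
Proof. induction k as [|k IH]; [reflexivity|]; simpl; rewrite IH; ring. Qed.

Lemma smoothstep_poly_sym (k : nat) (t : C) :
  peval (smoothstep_poly k) (1 - t)%C = (1 - peval (smoothstep_poly k) t)%C.
Proof.
  induction k as [|k IH]; [reflexivity|]; simpl; rewrite IH.
  change (RtoC (-2)) with (RtoC (- (2))); rewrite RtoC_opp; ring.
Qed.

Lemma smoothstep_sym (k : nat) (t : R) : smoothstep k (1 - t) = 1 - smoothstep k t.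
Proof. induction k as [|k IH]; [reflexivity|]; simpl; rewrite IH; ring. Qed.

Lemma smoothstep_range (k : nat) (t : R) : 0 <= t <= 1 -> 0 <= smoothstep k t <= 1.
Proof.
  intros Ht; induction k as [|k IH]; [exact Ht|]; simpl.
  set (r := smoothstep k t) in *; split; [apply Rmult_le_pos; nra|].
  assert (0 <= (1 - r) * (1 - r) * (1 + 2 * r)) by (apply Rmult_le_pos; nra); nra.
Qed.

(** On [0, 1/2 - tau] one iteration multiplies by [r (3 - 2 r) <= 1 - tau], and
    it does not leave that interval.  The estimate near 1 follows from
    [smoothstep_sym]. *)
Lemma smoothstep_small (k : nat) (tau t : R) :
  0 <= tau -> 0 <= t <= 1 / 2 - tau -> smoothstep k t <= (1 - tau) ^ k * t.
Proof.
  intros Htau Ht.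
  assert (P : smoothstep k t <= t /\ smoothstep k t <= (1 - tau) ^ k * t);
    [|exact (proj2 P)].
  induction k as [|k [IH1 IH2]]; [simpl; lra|].
  assert (H0 : 0 <= smoothstep k t <= 1) by (apply smoothstep_range; lra).
  assert (H1 : smoothstep (S k) t <= (1 - tau) * smoothstep k t).
  { simpl; set (r := smoothstep k t) in *.
    assert (r * (3 - 2 * r) <= 1 - tau) by nra. nra. }
  split; [nra|].
  eapply Rle_trans; [exact H1|]; simpl.
  rewrite Rmult_assoc; apply Rmult_le_compat_l; lra.
Qed.

Lemma ratio_le_weight (u v : R) : 0 < u <= v -> u / v <= 4 * (v * u / (v + u) ^ 2).
Proof.
  intros H; apply Rmult_le_reg_r with (v * (v + u) ^ 2).
  - apply Rmult_lt_0_compat; [|apply pow_lt]; lra.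
  - replace (u / v * (v * (v + u) ^ 2)) with (u * (v + u) ^ 2) by (field; lra).
    replace (4 * (v * u / (v + u) ^ 2) * (v * (v + u) ^ 2)) with (u * (2 * v) ^ 2)
      by (field; lra).
    apply Rmult_le_compat_l; [lra|]; apply pow_incr; lra.
Qed.

(** Near 0 the polynomial is [O(t)]; near 1 it is [1 - O(1 - t)], and the constant
    1 has no imaginary part.  So the imaginary part is small both for [y0] far
    below and for [y0] far above [|z|]. *)
Lemma Im_smoothstep_le (k : nat) :
  exists L, 0 <= L /\ forall z y0, right_half_plane z -> 0 < y0 ->
    Rabs (Im (peval (smoothstep_poly k) (moebius y0 z)))
      <= L * (Cmod z * y0 / (Cmod z + y0) ^ 2).
Proof.
  destruct (peval_Lipschitz_at_0 (smoothstep_poly k) (smoothstep_poly_0 k)) as [L [HL H]].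
  exists (4 * L); split; [lra|]; intros z y0 Hz Hy0.
  pose proof (proj1 (Cmod_gt_0 z) (right_half_plane_neq_0 z Hz)) as Hr.
  destruct (Cmod_one_minus_moebius y0 z Hz Hy0) as [O1 O2].
  set (t := moebius y0 z) in *; set (r := Cmod z) in *.
  assert (E1 : Rabs (Im (peval (smoothstep_poly k) t)) <= L * (y0 / r)).
  { eapply Rle_trans; [apply im_le_Cmod|].
    eapply Rle_trans; [apply H, Cmod_moebius_le_1; assumption|].
    apply Rmult_le_compat_l; [exact HL|apply Cmod_moebius_le; assumption]. }
  assert (E2 : Rabs (Im (peval (smoothstep_poly k) t)) <= L * (r / y0)).
  { replace (Im (peval (smoothstep_poly k) t))
      with (- Im (peval (smoothstep_poly k) (1 - t)%C))
      by (rewrite smoothstep_poly_sym; destruct (peval (smoothstep_poly k) t); simpl; ring).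
    rewrite Rabs_Ropp; eapply Rle_trans; [apply im_le_Cmod|].
    eapply Rle_trans; [apply H; exact O1|].
    apply Rmult_le_compat_l; [exact HL|exact O2]. }
  clearbody r.
  replace (4 * L * (r * y0 / (r + y0) ^ 2)) with (L * (4 * (r * y0 / (r + y0) ^ 2))) by ring.
  destruct (Rle_dec y0 r) as [Hle|Hgt].
  - eapply Rle_trans; [exact E1|]; apply Rmult_le_compat_l; [exact HL|].
    apply ratio_le_weight; lra.
  - eapply Rle_trans; [exact E2|]; apply Rmult_le_compat_l; [exact HL|].
    rewrite (Rmult_comm r y0), (Rplus_comm r y0); apply ratio_le_weight; lra.
Qed.

(** * Sums over a geometric sequence of nodes *)

Lemma is_series_telescope (b : nat -> R) (l : R) :
  is_lim_seq b l -> is_series (fun n => b (S n) - b n) (l - b O).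
Proof.
  intros Hb.
  assert (E : forall n, sum_n (fun n => b (S n) - b n) n = b (S n) - b O).
  { induction n as [|n IH]; [rewrite sum_O; reflexivity|].
    rewrite sum_Sn, IH; unfold plus; simpl; ring. }
  change (is_lim_seq (sum_n (fun n => b (S n) - b n)) (l - b O)).
  apply (is_lim_seq_ext (fun n => b (S n) - b O)); [intros n; rewrite E; reflexivity|].
  apply is_lim_seq_minus'; [apply -> is_lim_seq_incr_1; exact Hb|apply is_lim_seq_const].
Qed.

Section Geometric.

Variables (q : R) (y : nat -> R).
Hypothesis Hq : 0 < q < 1.
Hypothesis Hy : forall n, 0 < y n.
Hypothesis HyS : forall n, y (S n) = q * y n.
Hypothesis Hlim : is_lim_seq y 0.

Lemma geometric_decr (m n : nat) : (m <= n)%nat -> y n <= y m.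
Proof.
  induction 1 as [|n _ IH]; [lra|]; rewrite HyS; pose proof (Hy n); nra.
Qed.

Lemma geometric_bracket (x : R) :
  0 < x <= y O -> exists n, y (S n) < x <= y n.
Proof.
  intros [Hx H0].
  assert (E : exists N, y N < x).
  { apply is_lim_seq_spec in Hlim; destruct (Hlim (mkposreal x Hx)) as [N HN].
    exists N; specialize (HN N (le_n N)); simpl in HN.
    apply Rabs_def2 in HN; lra. }
  destruct E as [N HN]; induction N as [|N IH]; [lra|].
  destruct (Rlt_dec (y N) x) as [H|H]; [exact (IH H)|]; exists N; lra.
Qed.

(** Up to the factor [1 - q], each term is at most the difference of the values
    of [s / (x + s)] at [s = y n] and [s = y (n+1)]; these values lie in [0, 1]. *)
Lemma weight_series (x : R) :
  0 < x ->
  ex_series (fun n => x * y n / (x + y n) ^ 2) /\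
  Series (fun n => x * y n / (x + y n) ^ 2) <= / (1 - q).
Proof.
  intros Hx.
  pose (g := fun n => - (y n / (x + y n))).
  assert (Hg : is_lim_seq g 0).
  { replace (Finite 0) with (Finite (- (0 / (x + 0)))) by (f_equal; field; lra).
    apply is_lim_seq_opp with (l := Finite (0 / (x + 0))).
    apply is_lim_seq_div'; [exact Hlim| |lra].
    apply is_lim_seq_plus'; [apply is_lim_seq_const|exact Hlim]. }
  pose proof (is_series_telescope g 0 Hg) as T.
  assert (T' : is_series (fun n => / (1 - q) * (g (S n) - g n)) (/ (1 - q) * (0 - g O)))
    by exact (is_series_scal_l (K := R_AbsRing) _ _ _ T).
  assert (B : forall n, 0 <= x * y n / (x + y n) ^ 2 <= / (1 - q) * (g (S n) - g n)).
  { intros n; pose proof (Hy n) as Hn; split.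
    - apply Rdiv_le_0_compat; [nra|apply pow_lt; lra].
    - unfold g; rewrite HyS.
      assert (0 < q * y n) by nra.
      replace (/ (1 - q) * (- (q * y n / (x + q * y n)) - - (y n / (x + y n))))
        with (x * y n / ((x + y n) * (x + q * y n))) by (field; lra).
      unfold Rdiv; apply Rmult_le_compat_l; [nra|].
      apply Rinv_le_contravar; [apply Rmult_lt_0_compat; lra|].
      simpl; rewrite Rmult_1_r; apply Rmult_le_compat_l; nra. }
  split.
  - apply ex_series_le_R with (fun n => / (1 - q) * (g (S n) - g n)).
    + intros n; rewrite Rabs_pos_eq; apply B.
    + eexists; exact T'.
  - eapply Rle_trans; [apply (Series_le _ _ B); eexists; exact T'|].
    rewrite (is_series_unique _ _ T'); rewrite <- (Rmult_1_r (/ (1 - q))) at 2.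
    apply Rmult_le_compat_l; [left; apply Rinv_0_lt_compat; lra|].
    unfold g; pose proof (Hy 0%nat).
    replace (0 - - (y 0%nat / (x + y 0%nat))) with (y 0%nat / (x + y 0%nat)) by ring.
    apply Rle_div_l; lra.
Qed.

(** By telescoping, [b m - b 0] is the same series with [smoothstep k (t n)]
    replaced by the sharp step, 1 for [n < m] and 0 for [n >= m].  Each factor
    differs from the sharp step by at most twice [eta] times the weight of
    [weight_series], except for [n = m] and [n = m + 1], where [t n] may be
    close to 1/2 and the bound is 1. *)
Lemma smoothstep_sum (b : nat -> R) (A : R) (k m : nat) (x : R) :
  (forall n, Rabs (b (S n) - b n) <= A) ->
  y (S m) < x <= y m ->
  Rabs (b O + Series (fun n => (b (S n) - b n) * smoothstep k (y n / (x + y n))) - b m)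
    <= A * (2 + 2 * (1 - (1 - q) / (2 * (1 + q))) ^ k / (1 - q)).
Proof.
  intros HA Hx; set (tau := (1 - q) / (2 * (1 + q))); set (eta := (1 - tau) ^ k).
  pose proof (Hy m) as Hym; pose proof (Hy (S m)) as Hym1.
  assert (Hx0 : 0 < x) by lra.
  destruct (weight_series x Hx0) as [W1 W2].
  set (w := fun n => x * y n / (x + y n) ^ 2) in *.
  set (t := fun n => y n / (x + y n)).
  assert (Ht : forall n, 0 <= t n <= 1).
  { intros n; pose proof (Hy n); unfold t; split; [apply Rdiv_le_0_compat; lra|].
    apply Rle_div_l; lra. }
  assert (Htau : tau = 1 / 2 - q / (1 + q)) by (unfold tau; field; lra).
  assert (Htau0 : 0 <= tau) by (unfold tau; apply Rdiv_le_0_compat; lra).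
  assert (Hq2 : q / (1 + q) <= 1 / 2) by lra.
  assert (Heta : 0 <= eta).
  { apply pow_le; assert (0 <= q / (1 + q)) by (apply Rdiv_le_0_compat; lra); lra. }
  assert (Hfrac : forall u v, 0 < v -> 0 <= u <= q * v -> u / (u + v) <= q / (1 + q)).
  { intros u v Hv Hu; apply Rle_div_l; [lra|].
    replace (q / (1 + q) * (u + v)) with (q * (u + v) / (1 + q)) by (field; lra).
    apply Rle_div_r; [lra|]; nra. }
  assert (Hw : forall n, w n = t n * (1 - t n)).
  { intros n; pose proof (Hy n); unfold w, t; field; lra. }
  assert (Ht1 : forall n, 1 - t n = x / (x + y n)).
  { intros n; pose proof (Hy n); unfold t; field; lra. }
  assert (Lo : forall n, (n < m)%nat -> 1 - smoothstep k (t n) <= 2 * eta * w n).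
  { intros n Hn.
    assert (x <= q * y n).
    { rewrite <- HyS; pose proof (geometric_decr (S n) m Hn); lra. }
    pose proof (Hfrac x (y n) (Hy n) ltac:(lra)) as E; rewrite <- Ht1 in E.
    pose proof (smoothstep_small k tau (1 - t n) Htau0 ltac:(pose proof (Ht n); lra)) as S.
    fold eta in S; rewrite smoothstep_sym in S; rewrite Hw.
    pose proof (Ht n); assert (0 <= eta * (1 - t n)) by (apply Rmult_le_pos; lra).
    assert (0 <= eta * (1 - t n) * (2 * t n - 1)) by (apply Rmult_le_pos; lra); lra. }
  assert (Hi : forall n, (m + 2 <= n)%nat -> smoothstep k (t n) <= 2 * eta * w n).
  { intros n Hn.
    assert (y n <= q * x).
    { destruct n as [|n]; [lia|]; rewrite HyS.
      pose proof (geometric_decr (S m) n ltac:(lia)); nra. }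
    pose proof (Hy n).
    pose proof (Hfrac (y n) x Hx0 ltac:(lra)) as E; rewrite Rplus_comm in E.
    fold (t n) in E.
    pose proof (smoothstep_small k tau (t n) Htau0 ltac:(pose proof (Ht n); lra)) as S.
    fold eta in S; rewrite Hw.
    pose proof (Ht n); assert (0 <= eta * t n) by (apply Rmult_le_pos; lra).
    assert (0 <= eta * t n * (1 - 2 * t n)) by (apply Rmult_le_pos; lra); lra. }
  (* The increments of [bm] are those of [b] below [m] and vanish from [m] on;
     the increments of [c] are 1 at [m] and [m + 1] and 0 elsewhere. *)
  pose (bm := fun n => b (Nat.min n m)).
  pose (c := fun n => INR (Nat.min (n - m) 2)).
  assert (Sb : is_series (fun n => bm (S n) - bm n) (b m - b O)).
  { apply (is_series_telescope bm).
    apply is_lim_seq_ext_loc with (fun _ => b m); [|apply is_lim_seq_const].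
    exists m; intros n Hn; unfold bm; rewrite Nat.min_r by exact Hn; reflexivity. }
  assert (Sc : is_series (fun n => c (S n) - c n) 2).
  { replace 2 with (2 - c O) at 1 by (unfold c; simpl; lra).
    apply (is_series_telescope c).
    apply is_lim_seq_ext_loc with (fun _ => 2); [|apply is_lim_seq_const].
    exists (m + 2)%nat; intros n Hn; unfold c; rewrite Nat.min_r by lia; simpl; lra. }
  assert (HA0 : 0 <= A) by (eapply Rle_trans; [apply Rabs_pos|apply (HA O)]).
  pose (bd := fun n => A * ((c (S n) - c n) + 2 * eta * w n)).
  assert (Ebd : is_series bd (A * (2 + 2 * eta * Series w))).
  { apply (is_series_scal_l (K := R_AbsRing) A (fun n => (c (S n) - c n) + 2 * eta * w n)).
    apply (is_series_plus (K := R_AbsRing) (V := R_NormedModule) _ (fun n => 2 * eta * w n));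
      [exact Sc|].
    apply (is_series_scal_l (K := R_AbsRing) (2 * eta) w), Series_correct, W1. }
  pose (d := fun n => (b (S n) - b n) * smoothstep k (t n) - (bm (S n) - bm n)).
  assert (Hd : forall n, Rabs (d n) <= bd n).
  { intros n; unfold d, bd.
    pose proof (smoothstep_range k (t n) (Ht n)) as Hs.
    assert (Hwn : 0 <= 2 * eta * w n).
    { rewrite Hw; pose proof (Ht n); apply Rmult_le_pos; [|apply Rmult_le_pos]; lra. }
    destruct (Nat.lt_ge_cases n m) as [Hn|Hn].
    - unfold bm; rewrite !Nat.min_l by lia.
      replace ((b (S n) - b n) * smoothstep k (t n) - (b (S n) - b n))
        with ((b (S n) - b n) * - (1 - smoothstep k (t n))) by ring.
      unfold c; replace (S n - m)%nat with O by lia; replace (n - m)%nat with O by lia.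
      rewrite Rabs_mult, Rabs_Ropp, (Rabs_pos_eq (1 - _)) by lra.
      apply Rmult_le_compat; [apply Rabs_pos|lra|apply HA|].
      simpl; pose proof (Lo n Hn); lra.
    - unfold bm; rewrite !Nat.min_r by lia.
      rewrite Rminus_diag, Rminus_0_r.
      rewrite Rabs_mult, (Rabs_pos_eq (smoothstep _ _)) by lra.
      apply Rmult_le_compat; [apply Rabs_pos|lra|apply HA|].
      destruct (Nat.lt_ge_cases n (m + 2)) as [Hn2|Hn2].
      + replace (c (S n) - c n) with 1; [lra|].
        unfold c; rewrite !Nat.min_l, <- minus_INR by lia.
        replace (S n - m - (n - m))%nat with 1%nat by lia; reflexivity.
      + unfold c; rewrite !Nat.min_r by lia; pose proof (Hi n Hn2); lra. }
  assert (Eb : ex_series bd) by (eexists; exact Ebd).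
  assert (Ed : ex_series d) by (exact (ex_series_le_R d bd Hd Eb)).
  assert (ESb : ex_series (fun n => bm (S n) - bm n)) by (eexists; exact Sb).
  replace (b O + Series (fun n => (b (S n) - b n) * smoothstep k (y n / (x + y n))) - b m)
    with (Series d).
  2: { pose proof (Series_plus d _ Ed ESb) as P.
       rewrite (is_series_unique _ _ Sb) in P.
       rewrite (Series_ext (fun n => (b (S n) - b n) * smoothstep k (y n / (x + y n)))
         (fun n => d n + (bm (S n) - bm n))) by (intros n; unfold d, t; ring).
       rewrite P; ring. }
  eapply Rle_trans; [exact (Series_abs_le d bd Hd Eb)|].
  rewrite (is_series_unique _ _ Ebd); apply Rmult_le_compat_l; [exact HA0|].
  apply Rplus_le_compat_l; unfold Rdiv; apply Rmult_le_compat_l; [lra|exact W2].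
Qed.

Lemma blend_Im_le (a : nat -> R) (A L : R) (p : cpoly) (z : C) :
  (forall n, Rabs (a n) <= A) -> 0 <= L ->
  (forall y0, 0 < y0 ->
    Rabs (Im (peval p (moebius y0 z))) <= L * (Cmod z * y0 / (Cmod z + y0) ^ 2)) ->
  right_half_plane z ->
  Rabs (Im (blend a y p z)) <= A * L / (1 - q).
Proof.
  intros HA HL H Hz.
  pose proof (proj1 (Cmod_gt_0 z) (right_half_plane_neq_0 z Hz)) as Hr.
  destruct (weight_series (Cmod z) Hr) as [W1 W2].
  assert (HA0 : 0 <= A) by (eapply Rle_trans; [apply Rabs_pos|apply (HA O)]).
  unfold blend, CSeries.
  change (Rabs (Series (fun n => Im (a n * peval p (moebius (y n) z))%C)) <= A * L / (1 - q)).
  eapply Rle_trans; [apply (Series_abs_le _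
    (fun n => (A * L) * (Cmod z * y n / (Cmod z + y n) ^ 2)))|].
  - intros n; rewrite im_mult; simpl (Im (RtoC _)); simpl (Re (RtoC _)).
    rewrite Rmult_0_l, Rplus_0_r, Rabs_mult.
    rewrite Rmult_assoc; apply Rmult_le_compat; auto using Rabs_pos.
  - exact (ex_series_scal_l (K := R_AbsRing) _ _ W1).
  - rewrite Series_scal_l; unfold Rdiv at 2; apply Rmult_le_compat_l; [nra|exact W2].
Qed.

End Geometric.

(** * The sector and the class B *)

Lemma sector_right_half_plane (r beta : R) (z : C) :
  beta < PI -> sector r beta z -> right_half_plane z.
Proof.
  intros Hb [[Hz _] [t [[_ [_ E]] Ht]]]; unfold right_half_plane.
  rewrite E; simpl; rewrite Rmult_0_l, Rminus_0_r.
  apply Rmult_lt_0_compat; [exact Hz|]; apply cos_gt_0; lra.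
Qed.

Lemma sector_real (r alpha x : R) : 0 < alpha -> 0 < x < r -> sector r alpha x.
Proof.
  intros Ha Hx; pose proof PI_RGT_0; split.
  - rewrite Cmod_R, Rabs_pos_eq; lra.
  - exists 0; split; [split; [|split; [lra|]]|lra].
    + intros E; apply RtoC_inj in E; lra.
    + rewrite Cmod_R, Rabs_pos_eq, cos_0, sin_0 by lra.
      change (1, 0) with (RtoC 1); ring.
Qed.

(** The mean value theorem on [s, t], where the derivative is at most [M / s]. *)
Lemma class_B_Re_slow (r alpha M : R) (F : C -> C) (s t : R) :
  0 < alpha -> class_B_with r alpha M F -> 0 < s <= t -> t < r ->
  Rabs (Re (F t) - Re (F s)) <= M * ((t - s) / s).
Proof.
  intros Ha [HF HM] Hs Ht.
  assert (D : forall x, s <= x <= t ->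
    is_derive (fun x => Re (F (RtoC x))) x (Re (C_derive F x))).
  { intros x Hx.
    exact (Re_is_derive_x F x _
      (C_derive_correct F x x (HF x (sector_real r alpha x Ha ltac:(lra))))). }
  destruct (MVT_gen (fun x => Re (F (RtoC x))) s t (fun x => Re (C_derive F x)))
    as [c [Hc E]].
  - rewrite Rmin_left, Rmax_right by lra; intros x Hx; apply D; lra.
  - rewrite Rmin_left, Rmax_right by lra; intros x Hx.
    apply continuity_pt_filterlim.
    apply (ex_derive_continuous (fun x => Re (F (RtoC x)))); eexists; apply D; exact Hx.
  - rewrite Rmin_left, Rmax_right in Hc by lra.
    rewrite E, Rabs_mult, (Rabs_pos_eq (t - s)) by lra.
    pose proof (HM c (sector_real r alpha c Ha ltac:(lra))) as HMc.
    rewrite Cmod_R, Rabs_pos_eq in HMc by lra.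
    assert (HM0 : 0 <= M).
    { apply Rmult_le_reg_r with (/ c); [apply Rinv_0_lt_compat; lra|].
      rewrite Rmult_0_l; eapply Rle_trans; [apply Cmod_ge_0|exact HMc]. }
    replace (M * ((t - s) / s)) with (M / s * (t - s)) by (field; lra).
    apply Rmult_le_compat_r; [lra|].
    eapply Rle_trans; [apply re_le_Cmod|]; eapply Rle_trans; [exact HMc|].
    apply Rmult_le_compat_l; [exact HM0|apply Rinv_le_contravar; lra].
Qed.

Lemma harmonic_on_subset (D E : C -> Prop) (u : C -> R) :
  (forall z, D z -> E z) -> harmonic_on E u -> harmonic_on D u.
Proof.
  intros S [[A [B B']] L].
  exact (conj (conj (fun z Hz => A z (S z Hz))
                (conj (fun z Hz => B z (S z Hz)) (fun z Hz => B' z (S z Hz))))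
           (fun z Hz => L z (S z Hz))).
Qed.

Theorem theorem1p2 :
  forall eps : R, 0 < eps ->
  exists delta : R, 0 < delta < 1 / 2 /\
  forall alpha beta M : R,
    0 < alpha -> alpha < beta -> beta < PI -> 0 < M ->
  exists Cst : R,
  forall F : C -> C, class_B_with (1 / 2) alpha M F ->
  exists u u_conj : C -> R,
    harmonic_on (sector 1 beta) u /\
    harmonic_conjugate (sector 1 beta) (RtoC (1 / 2)) u u_conj /\
    (forall x : R, 0 < x <= delta ->
       Rabs (u (RtoC x) - Re (F (RtoC x))) <= eps) /\
    (forall z : C, sector 1 beta z -> Rabs (u_conj z) <= Cst).
Proof.
  intros eps Heps; exists (1 / 4); split; [lra|].
  intros alpha beta M Ha _ Hb HM.
  (* The error is at most [5 A]: [4 A] between [H] and the step function and [A]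
     between the step function and [f]; [q] makes [M (1/q - 1)] equal to [A]. *)
  set (A := eps / 6); set (q := / (1 + A / M)).
  assert (HA0 : 0 < A) by (unfold A; lra).
  assert (HAM : 0 < A / M) by (apply Rdiv_lt_0_compat; lra).
  assert (Hq : 0 < q < 1).
  { unfold q; split; [apply Rinv_0_lt_compat; lra|].
    rewrite <- Rinv_1 at 2; apply Rinv_lt_contravar; lra. }
  assert (HqA : M * ((1 - q) / q) = A) by (unfold q; field; lra).
  set (eta := 1 - (1 - q) / (2 * (1 + q))).
  assert (Heta : 0 < eta < 1).
  { assert (0 < (1 - q) / (2 * (1 + q)) < 1); [|unfold eta; lra].
    split; [apply Rdiv_lt_0_compat; lra|apply Rlt_div_l; lra]. }
  destruct (pow_lt_1_zero eta ltac:(rewrite Rabs_pos_eq; lra) (1 - q) ltac:(lra))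
    as [k Hk].
  specialize (Hk k (le_n k)); apply Rabs_def2 in Hk; destruct Hk as [Hk _].
  destruct (Im_smoothstep_le k) as [L [HL HIm]].
  exists (A * L / (1 - q)); intros F HF.
  pose (y := fun n => 1 / 4 * q ^ n).
  assert (Hy : forall n, 0 < y n)
    by (intros n; apply Rmult_lt_0_compat; [lra|apply pow_lt; lra]).
  assert (HyS : forall n, y (S n) = q * y n) by (intros n; unfold y; simpl; ring).
  assert (Hlim : is_lim_seq y 0).
  { replace (Finite 0) with (Rbar_mult (1 / 4) 0) by (simpl; f_equal; ring).
    apply is_lim_seq_scal_l, is_lim_seq_geom; rewrite Rabs_pos_eq; lra. }
  assert (Hys : ex_series y).
  { apply (ex_series_scal_l (K := R_AbsRing) (1 / 4) (fun n => q ^ n)), ex_series_geom.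
    rewrite Rabs_pos_eq; lra. }
  assert (Hy0 : y O = 1 / 4) by (unfold y; simpl; ring).
  assert (Hy4 : forall n, y n <= 1 / 4).
  { intros n; rewrite <- Hy0; apply (geometric_decr q y Hq Hy HyS); lia. }
  assert (Hy1 : forall n, 0 < y n <= 1) by (intros n; specialize (Hy4 n); split; [auto|lra]).
  pose (b := fun n => Re (F (y n))).
  pose (a := fun n => b (S n) - b n).
  assert (slow : forall n x, y (S n) <= x <= y n -> Rabs (b n - Re (F x)) <= A).
  { intros n x Hx; pose proof (Hy (S n)) as P; pose proof (Hy n) as P'.
    eapply Rle_trans; [apply (class_B_Re_slow (1 / 2) alpha M F x (y n) Ha HF)|].
    - lra.
    - specialize (Hy4 n); lra.
    - rewrite <- HqA; apply Rmult_le_compat_l; [lra|].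
      replace ((y n - x) / x) with (y n * / x - 1) by (field; lra).
      replace ((1 - q) / q) with (y n * / (q * y n) - 1) by (field; lra).
      rewrite HyS in *.
      apply Rplus_le_compat_r, Rmult_le_compat_l; [lra|apply Rinv_le_contravar; lra]. }
  assert (HaA : forall n, Rabs (a n) <= A).
  { intros n; unfold a; rewrite Rabs_minus_sym; apply slow; rewrite HyS.
    specialize (Hy n); nra. }
  pose (p := smoothstep_poly k).
  pose (H := blend a y p).
  assert (Hp : peval p 0 = 0) by apply smoothstep_poly_0.
  assert (sub : forall z, sector 1 beta z -> right_half_plane z)
    by (intros z; apply sector_right_half_plane; exact Hb).
  assert (ReH : forall x, 0 < x ->
    H (RtoC x) = RtoC (Series (fun n => a n * smoothstep k (y n / (x + y n))))).
  { intros x Hx; unfold H, blend, CSeries.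
    assert (E : forall n, (a n * peval p (moebius (y n) x))%C
        = RtoC (a n * smoothstep k (y n / (x + y n)))).
    { intros n; specialize (Hy n); unfold moebius.
      rewrite <- RtoC_plus, <- RtoC_div by lra; unfold p.
      rewrite smoothstep_poly_R, <- RtoC_mult; reflexivity. }
    apply injective_projections; cbn [fst snd RtoC].
    - apply Series_ext; intros n; rewrite E; reflexivity.
    - rewrite (Series_ext _ (fun n => 0 * 0)) by (intros n; rewrite E; simpl; ring).
      rewrite (Series_scal_l 0 (fun _ => 0)); ring. }
  exists (fun z => Re (b O + 1 * H z)%C), (fun z => Re (0 + - Ci * H z)%C).
  assert (ImH : forall z, Re (0 + - Ci * H z)%C = Im (H z))
    by (intros z; destruct (H z); simpl; ring).
  split; [|split; [split; [|split]|split]].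
  - apply (harmonic_on_subset _ _ _ sub), (blend_harmonic a y A HaA Hy1 Hys p _ _ Hp).
  - apply (harmonic_on_subset _ _ _ sub), (blend_harmonic a y A HaA Hy1 Hys p _ _ Hp).
  - intros z Hz; eexists.
    apply (is_derive_ext (K := C_AbsRing) (V := C_NormedModule) (fun z => b O + H z)%C).
    + intros w; destruct (H w); apply injective_projections; simpl; ring.
    + apply is_C_derive_add_const, (blend_derive a y A HaA Hy1 Hys p z (sub z Hz) Hp).
  - rewrite ImH, ReH by lra; reflexivity.
  - intros x Hx.
    destruct (geometric_bracket y Hlim x) as [m Hm]; [lra|].
    assert (S : Rabs (b O + Series (fun n => a n * smoothstep k (y n / (x + y n))) - b m)
                <= A * (2 + 2 * eta ^ k / (1 - q)))
      by exact (smoothstep_sum q y Hq Hy HyS Hlim b A k m x HaA Hm).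
    rewrite ReH by lra.
    assert (E : A * (2 + 2 * eta ^ k / (1 - q)) <= A * 4).
    { apply Rmult_le_compat_l; [unfold A; lra|].
      assert (2 * eta ^ k / (1 - q) <= 2); [|lra].
      apply Rle_div_l; lra. }
    pose proof (slow m x ltac:(lra)) as S'.
    replace (Re (b O + 1 * RtoC (Series (fun n => (a n * smoothstep k (y n / (x + y n)))%R)))%C
        - Re (F x))
      with ((b O + Series (fun n => a n * smoothstep k (y n / (x + y n))) - b m)
        + (b m - Re (F x))) by (simpl; ring).
    eapply Rle_trans; [apply Rabs_triang|]; unfold A in *; lra.
  - intros z Hz; rewrite ImH.
    exact (blend_Im_le q y Hq Hy HyS Hlim a A L p z HaA HL
      (fun y0 => HIm z y0 (sub z Hz)) (sub z Hz)).
Qed.
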